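(* Let $t\mapsto(\mathbf{u}(t),\mathbf{r}(t))\in\mathbb{C}^N\times\mathbb{R}^N$ be a differentiable solution of the semi-discrete system $$\mathbf{u}_t=\mathrm{i}D_1^2\mathbf{u}+\mathrm{i}\beta\,\mathbf{r}\cdot\mathbf{u},\qquad \mathbf{r}_t=\bar{\mathbf{u}}\cdot\mathbf{u}_t+\mathbf{u}\cdot\bar{\mathbf{u}}_t .$$ Then the semi-discrete modified energy conservation law holds: $$\frac{\mathrm{d}}{\mathrm{d}t}E(\mathbf{u},\mathbf{r})=\frac{\mathrm{d}}{\mathrm{d}t}\Big(-\frac12\|D_1\mathbf{u}\|^2+\frac{\beta}{4}\|\mathbf{r}\|^2\Big)=0 .$$
   Context: $[a,b]$ is an interval of length $L=b-a$, $N$ is an even positive integer, $h=L/N$, $x_j=a+jh$, $\mu=2\pi/L$, and $\beta\in\mathbb{R}$ is a constant. $D_1$ is the real skew-symmetric $N\times N$ Fourier spectral differentiation matrix with entries, for $j,l=0,\dots,N-1$, $(D_1)_{j+1,l+1}=\frac12(-1)^{j+l}\mu\cot\!\big(\mu\frac{x_j-x_l}{2}\big)$ if $j\ne l$ and $(D_1)_{j+1,j+1}=0$. For vectors, $\mathbf{u}\cdot\mathbf{v}$ denotes the componentwise product, $\bar{\mathbf{u}}$ the componentwise complex conjugate, $(\mathbf{u},\mathbf{v})=h\sum_{i=0}^{N-1}u_i\bar v_i$ and $\|\mathbf{u}\|^2=(\mathbf{u},\mathbf{u})$. The discrete energy is $E(\mathbf{u},\mathbf{r})=-\frac12\|D_1\mathbf{u}\|^2+\frac{\beta}{4}\|\mathbf{r}\|^2$.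 *)

(* Defs.v *)
From HB Require Import structures.
From mathcomp Require Import all_boot all_order all_algebra.
From mathcomp Require Import complex.
From mathcomp Require Import all_classical all_reals all_analysis.

Set Implicit Arguments.
Unset Strict Implicit.
Unset Printing Implicit Defensive.

Import Order.TTheory GRing.Theory Num.Theory.
Import numFieldNormedType.Exports.

Local Open Scope classical_set_scope.
Local Open Scope ring_scope.

(* [Rcomplex R] is the alias of [R[i]] that carries the structure of a real
   vector space with norm [sqrt (x ^+ 2 + y ^+ 2)].  We equip it with the
   topology of this norm, so that [derivable] and [derive1] apply to
   complex-valued functions of a real variable. *)
Lemma normcZ (R : realType) (k : R) (z : Rcomplex R) : `|k *: z| = `|k| * `|z|.
Proof.
case: z => x y; rewrite /Num.norm/= !exprMn -mulrDr sqrtrM ?sqr_ge0//.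
by rewrite sqrtr_sqr.
Qed.

HB.instance Definition _ (R : realType) :=
  PseudoMetric.copy (Rcomplex R) (pseudoMetric_normed (Rcomplex R)).
HB.instance Definition _ (R : realType) := isPointed.Build (Rcomplex R) 0.
HB.instance Definition _ (R : realType) :=
  NormedZmod_PseudoMetric_eq.Build R (Rcomplex R) erefl.
HB.instance Definition _ (R : realType) :=
  PseudoMetricNormedZmod_Lmodule_isNormedModule.Build R (Rcomplex R)
    (@normcZ R).

Definition vderivable (R : realType) (V : normedModType R) (n : nat)
    (f : R -> 'cV[V]_n) (t : R) : Prop :=
  forall i, derivable (fun s => f s i 0) t 1.

Definition vderive (R : realType) (V : normedModType R) (n : nat)
    (f : R -> 'cV[V]_n) (t : R) : 'cV[V]_n :=
  \col_i derive1 (fun s => f s i 0) t.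

Definition cderivable (R : realType) (n : nat) (u : R -> 'cV[R[i]]_n) (t : R)
  : Prop := @vderivable R (Rcomplex R) n u t.

Definition cderive (R : realType) (n : nat) (u : R -> 'cV[R[i]]_n) (t : R)
  : 'cV[R[i]]_n := @vderive R (Rcomplex R) n u t.

Definition to_complex (R : realType) (m n : nat) (A : 'M[R]_(m, n))
  : 'M[R[i]]_(m, n) := map_mx (real_complex R) A.

Definition cmul (R : realType) (n : nat) (u v : 'cV[R[i]]_n) : 'cV[R[i]]_n :=
  map2_mx *%R u v.

Definition cconj (R : realType) (n : nat) (u : 'cV[R[i]]_n) : 'cV[R[i]]_n :=
  map_mx conjc u.

Definition mesh (R : realType) (a b : R) (N : nat) : R := (b - a) / N%:R.

Definition grid (R : realType) (a b : R) (N j : nat) : R :=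
  a + j%:R * mesh a b N.

Definition cot (R : realType) (x : R) : R := cos x / sin x.

Definition D1 (R : realType) (a b : R) (N : nat) : 'M[R]_N :=
  let mu := 2 * pi / (b - a) in
  \matrix_(j < N, l < N)
    if j == l then 0
    else 2^-1 * (-1) ^+ (j + l) * mu
         * cot (mu * ((grid a b N j - grid a b N l) / 2)).

Definition inner (R : realType) (a b : R) (N : nat) (u v : 'cV[R[i]]_N) : R[i] :=
  (mesh a b N)%:C%C * \sum_(i < N) u i 0 * conjc (v i 0).

(* [inner a b u u] is real, see [normsqE] below. *)
Definition normsq (R : realType) (a b : R) (N : nat) (u : 'cV[R[i]]_N) : R :=
  complex.Re (inner a b u u).

Lemma normsqE (R : realType) (a b : R) (N : nat) (u : 'cV[R[i]]_N) :
  ((normsq a b u)%:C)%C = inner a b u u.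
Proof.
rewrite /normsq /inner.
have -> : \sum_(i < N) u i 0 * conjc (u i 0)
        = ((\sum_(i < N) (complex.Re (u i 0) ^+ 2 + complex.Im (u i 0) ^+ 2))%:C)%C.
  rewrite rmorph_sum/=; apply: eq_bigr => i _.
  case: (u i 0) => x y; apply/eqP; rewrite eq_complex/=.
  by rewrite mulrN opprK mulrN [y * x]mulrC addNr !expr2 !eqxx.
by rewrite -rmorphM.
Qed.

Definition energy (R : realType) (a b beta : R) (N : nat)
    (u : 'cV[R[i]]_N) (r : 'cV[R]_N) : R :=
  - (1 / 2) * normsq a b (to_complex (D1 a b N) *m u)
  + beta / 4 * normsq a b (to_complex r).

Definition semi_discrete_solution (R : realType) (a b beta : R) (N : nat)
    (J : set R) (u : R -> 'cV[R[i]]_N) (r : R -> 'cV[R]_N) : Prop :=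
  forall t, J t ->
  [/\ cderivable u t,
      @vderivable R R^o N r t,
      cderive u t
      = 'i%C *: (to_complex (D1 a b N *m D1 a b N) *m u t)
        + ('i%C * (beta%:C)%C) *: cmul (to_complex (r t)) (u t)
    & to_complex (@vderive R R^o N r t)
      = cmul (cconj (u t)) (cderive u t) + cmul (u t) (cconj (cderive u t))].

(* Main.v *)
Require Import Defs.
From mathcomp Require Import all_boot all_order all_algebra.
From mathcomp Require Import complex.
From mathcomp Require Import all_classical all_reals all_analysis.
From mathcomp Require Import ring.

Import Order.TTheory GRing.Theory Num.Theory.
Import numFieldNormedType.Exports.

Local Open Scope classical_set_scope.
Local Open Scope ring_scope.

(** The energy is conserved because its derivative is the real inner product
    of the velocity [u_t] with a vector orthogonal to it.  Put
    [w = D1^2 u + beta r . u], so that the first equation reads [u_t = i w].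
    Write [<p, q>] for the real part of [inner a b p q], a real-bilinear
    symmetric form whose quadratic form is [normsq].  The chain rule gives
    [dE/dt = - <D1 u, D1 u_t> + (beta / 2) <r, r_t>].

    Since [D1] is real and skew-symmetric ([D1_skew]; the cotangent is odd and
    the sign [(-1)^(j + l)] is symmetric), summation by parts
    ([Re_inner_skew]) turns the first term into [<D1^2 u, u_t>].  By the second
    equation [r_t] is twice the real part of [conj u . u_t], and [r] is real,
    so the second term is [beta <r . u, u_t>] ([Re_inner_cmul]).  The sum is
    [<w, u_t> = <w, i w>], which vanishes because multiplication by [i] is a
    rotation by a right angle ([Re_inner_i]).

    Differentiation happens in real coordinates: the real and imaginary
    parts are continuous linear maps, hence commute with the derivative of a
    complex-valued curve ([is_derive_linear]). *)

(** * The differentiation matrix *)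

Lemma cotN {R : realType} (x : R) : cot (- x) = - cot x.
Proof. by rewrite /cot cosN sinN invrN mulrN. Qed.

Lemma D1_skew {R : realType} (a b : R) (N : nat) :
  (D1 a b N)^T = - D1 a b N.
Proof.
apply/matrixP => j l; rewrite !mxE eq_sym; case: eqP => _; first by rewrite oppr0.
by rewrite addnC -(opprB (grid a b N j)) mulNr mulrN cotN mulrN.
Qed.

(** * The real inner product *)

Lemma Re_sum {R : realType} {n : nat} (F : 'I_n -> R[i]) :
  complex.Re (\sum_i F i) = \sum_i complex.Re (F i).
Proof. exact: (raddf_sum (@complex.Re R : {linear Rcomplex R -> R})). Qed.

Lemma Im_sum {R : realType} {n : nat} (F : 'I_n -> R[i]) :
  complex.Im (\sum_i F i) = \sum_i complex.Im (F i).
Proof. exact: (raddf_sum (@complex.Im R : {linear Rcomplex R -> R})). Qed.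

Lemma Re_innerE {R : realType} (a b : R) {n : nat} (u v : 'cV[R[i]]_n) :
  complex.Re (inner a b u v) =
  mesh a b n * \sum_i (complex.Re (u i 0) * complex.Re (v i 0)
                       + complex.Im (u i 0) * complex.Im (v i 0)).
Proof.
rewrite /inner.
have -> (c : R) (z : R[i]) : complex.Re (c%:C%C * z) = c * complex.Re z.
  by case: z => x y /=; rewrite mul0r subr0.
rewrite Re_sum; congr (_ * _); apply: eq_bigr => i _.
by case: (u i 0) => x y; case: (v i 0) => p q /=; rewrite mulrN opprK.
Qed.

Lemma Re_innerDl {R : realType} (a b : R) {n : nat} (u v w : 'cV[R[i]]_n) :
  complex.Re (inner a b (u + v) w) =
  complex.Re (inner a b u w) + complex.Re (inner a b v w).
Proof.
rewrite !Re_innerE -mulrDr -big_split; congr (_ * _).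
apply: eq_bigr => i _; rewrite !mxE.
by case: (u i 0) => x y; case: (v i 0) => p q /=; ring.
Qed.

Lemma Re_innerZl {R : realType} (a b : R) {n : nat} (k : R)
    (u v : 'cV[R[i]]_n) :
  complex.Re (inner a b (k%:C%C *: u) v) = k * complex.Re (inner a b u v).
Proof.
rewrite !Re_innerE mulrCA [k * \sum_i _]mulr_sumr; congr (_ * _).
apply: eq_bigr => i _; rewrite !mxE.
by case: (u i 0) => x y /=; ring.
Qed.

(** The adjoint of a real matrix is its transpose. *)
Lemma inner_adjoint {R : realType} (a b : R) {n : nat} (A : 'M[R]_n)
    (u v : 'cV[R[i]]_n) :
  inner a b (to_complex A *m u) v = inner a b u (to_complex A^T *m v).
Proof.
rewrite /inner; congr (_ * _).
under eq_bigr do rewrite mxE mulr_suml.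
rewrite exchange_big; apply: eq_bigr => j _ /=.
rewrite mxE (raddf_sum (@conjc R)) mulr_sumr; apply: eq_bigr => i _.
rewrite !mxE; case: (u j 0) => x y; case: (v i 0) => p q.
by apply/eqP; rewrite eq_complex /=; apply/andP; split; apply/eqP; ring.
Qed.

Lemma Re_inner_skew {R : realType} (a b : R) {n : nat} (A : 'M[R]_n)
    (u v : 'cV[R[i]]_n) : A^T = - A ->
  complex.Re (inner a b (to_complex A *m u) v) =
  - complex.Re (inner a b u (to_complex A *m v)).
Proof.
move=> skewA; rewrite inner_adjoint skewA !Re_innerE -mulrN -sumrN.
congr (_ * _); apply: eq_bigr => i _.
have -> : (to_complex (- A) *m v) i 0 = - (to_complex A *m v) i 0.
  by rewrite /to_complex map_mxN mulNmx mxE.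
by case: ((to_complex A *m v) i 0) => x y /=; ring.
Qed.

Lemma Re_inner_i {R : realType} (a b : R) {n : nat} (w : 'cV[R[i]]_n) :
  complex.Re (inner a b w ('i%C *: w)) = 0.
Proof.
rewrite Re_innerE big1 ?mulr0// => i _; rewrite mxE.
by case: (w i 0) => x y /=; ring.
Qed.

(** Componentwise, [r * conj (2 Re (conj u * v))] and [2 (r * u) * conj v]
    have the same real part when [r] is real. *)
Lemma Re_inner_cmul {R : realType} (a b : R) {n : nat} (r : 'cV[R]_n)
    (u v : 'cV[R[i]]_n) :
  complex.Re (inner a b (to_complex r)
                (cmul (cconj u) v + cmul u (cconj v))) =
  2 * complex.Re (inner a b (cmul (to_complex r) u) v).
Proof.
rewrite !Re_innerE mulrCA [2 * \sum_i _]mulr_sumr; congr (_ * _).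
apply: eq_bigr => i _; rewrite !mxE.
by case: (u i 0) => x y; case: (v i 0) => p q /=; ring.
Qed.

(** * Differentiation in real coordinates *)

(** A linear map of norm at most one passes inside the limit of the difference
    quotients. *)
Lemma is_derive_linear {R : realType} {V W : normedModType R}
    (g : {linear V -> W}) (f : R -> V) (t : R) :
  (forall z, `|g z| <= `|z|) -> derivable f t 1 ->
  is_derive t 1 (fun s => g (f s)) (g (derive1 f t)).
Proof.
move=> g_le df; rewrite derive1E.
have cg : continuous g.
  apply/linear_bounded_continuous/linear_boundedP.
  exists 1; split=> // r /ltW r_ge1 x.
  by rewrite (le_trans (g_le x))// ler_peMl.
have lim_g : h^-1 *: (((fun s => g (f s)) \o shift t) (h *: 1) - g (f t))
    @[h --> 0^'] --> g ('D_1 f t).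
  under eq_fun do rewrite /= -linearB -linearZ.
  exact: (continuous_cvg _ (cg _) df).
apply: DeriveDef; first by apply/cvg_ex; exists (g ('D_1 f t)).
exact: cvg_lim lim_g.
Qed.

Lemma is_derive_fct_sum {R : realType} {n : nat} {F : 'I_n -> R -> R} {t : R}
    {dF : 'I_n -> R} :
  (forall j, is_derive t 1 (F j) (dF j)) ->
  is_derive t 1 (fun s => \sum_j F j s) (\sum_j dF j).
Proof.
move=> dFj; have -> : (fun s => \sum_j F j s) = \sum_j F j.
  by apply/funext => s; rewrite fct_sumE.
exact: is_derive_sum.
Qed.

Lemma Re_le_norm {R : realType} (z : Rcomplex R) : `|complex.Re z| <= `|z|.
Proof.
by case: z => x y; rewrite -sqrtr_sqr ler_wsqrtr// lerDl sqr_ge0.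
Qed.

Lemma Im_le_norm {R : realType} (z : Rcomplex R) : `|complex.Im z| <= `|z|.
Proof.
by case: z => x y; rewrite -sqrtr_sqr ler_wsqrtr// lerDr sqr_ge0.
Qed.

(** The velocity of a curve in C^n is read in the 2n real coordinates because
    a real matrix acts linearly, and [normsq] is a sum of squares, in them: the
    derivation rules for real-valued functions then suffice. *)
Definition is_coord_derive {R : realType} {n : nat} (u : R -> 'cV[R[i]]_n)
    (t : R) (v : 'cV[R[i]]_n) : Prop :=
  forall i,
    is_derive t 1 (fun s => complex.Re (u s i 0)) (complex.Re (v i 0)) /\
    is_derive t 1 (fun s => complex.Im (u s i 0)) (complex.Im (v i 0)).

Lemma is_coord_derive_cderive {R : realType} {n : nat}
    {u : R -> 'cV[R[i]]_n} {t : R} :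
  cderivable u t -> is_coord_derive u t (cderive u t).
Proof.
move=> du i; rewrite mxE; split.
- exact: (@is_derive_linear R (Rcomplex R) R^o (@complex.Re R)
            _ _ (@Re_le_norm R) (du i)).
- exact: (@is_derive_linear R (Rcomplex R) R^o (@complex.Im R)
            _ _ (@Im_le_norm R) (du i)).
Qed.

Lemma is_coord_derive_to_complex {R : realType} {n : nat}
    {r : R -> 'cV[R]_n} {t : R} :
  @vderivable R R^o n r t ->
  is_coord_derive (fun s => to_complex (r s)) t
    (to_complex (@vderive R R^o n r t)).
Proof.
move=> dr i; split; under eq_fun do rewrite mxE /=; rewrite !mxE /=.
- by rewrite derive1E; apply: derivableP; exact: dr.
- exact: is_derive_cst.
Qed.

Lemma is_coord_derive_mulmx {R : realType} {n : nat} (A : 'M[R]_n)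
    {u : R -> 'cV[R[i]]_n} {t : R} {v : 'cV[R[i]]_n} :
  is_coord_derive u t v ->
  is_coord_derive (fun s => to_complex A *m u s) t (to_complex A *m v).
Proof.
have ReE (w : 'cV[R[i]]_n) i :
    complex.Re ((to_complex A *m w) i 0) = \sum_j A i j * complex.Re (w j 0).
  rewrite mxE Re_sum; apply: eq_bigr => j _; rewrite mxE.
  by case: (w j 0) => x y /=; ring.
have ImE (w : 'cV[R[i]]_n) i :
    complex.Im ((to_complex A *m w) i 0) = \sum_j A i j * complex.Im (w j 0).
  rewrite mxE Im_sum; apply: eq_bigr => j _; rewrite mxE.
  by case: (w j 0) => x y /=; ring.
move=> du i; split.
- under eq_fun do rewrite ReE.
  rewrite ReE; apply: is_derive_fct_sum => j.
  by apply: is_deriveZ; case: (du j).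
- under eq_fun do rewrite ImE.
  rewrite ImE; apply: is_derive_fct_sum => j.
  by apply: is_deriveZ; case: (du j).
Qed.

Lemma is_derive_normsq {R : realType} (a b : R) {n : nat}
    {u : R -> 'cV[R[i]]_n} {t : R} {v : 'cV[R[i]]_n} :
  is_coord_derive u t v ->
  is_derive t 1 (fun s => normsq a b (u s))
    (2 * complex.Re (inner a b (u t) v)).
Proof.
move=> du; rewrite /normsq.
under eq_fun do rewrite Re_innerE.
rewrite Re_innerE mulrCA mulr_sumr.
apply: is_deriveZ; apply: is_derive_fct_sum => i.
have [dRe dIm] := du i.
refine (is_derive_eq (is_deriveD (is_deriveM dRe dRe) (is_deriveM dIm dIm)) _).
by rewrite /GRing.scale /=; ring.
Qed.

(** * Conservation of the energy *)

Theorem theorem3p1 (R : realType) (a b beta : R) (N : nat)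
    (ltab : a < b) (N_gt0 : (0 < N)%N) (N_even : ~~ odd N)
    (J : set R) (J_open : open J) (J_itv : is_interval J)
    (u : R -> 'cV[R[i]]_N) (r : R -> 'cV[R]_N)
    (sol : semi_discrete_solution a b beta J u r) :
  forall t : R, J t ->
    is_derive t 1 (fun s : R => energy a b beta (u s) (r s)) 0.
Proof.
move=> t Jt; have [du dr eq_u eq_r] := sol t Jt.
move: (is_coord_derive_cderive du) (is_coord_derive_to_complex dr).
rewrite eq_r; set v := cderive u t => du' dr'.
set w := to_complex (D1 a b N) *m (to_complex (D1 a b N) *m u t)
         + beta%:C%C *: cmul (to_complex (r t)) (u t).
have vE : v = 'i%C *: w.
  by rewrite /v eq_u /to_complex map_mxM -mulmxA scalerDr scalerA.
have dEkin := is_derive_normsq a b (is_coord_derive_mulmx (D1 a b N) du').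
have dEpot := is_derive_normsq a b dr'.
refine (is_derive_eq (is_deriveD (is_deriveZ (- (1 / 2)) dEkin)
                                 (is_deriveZ (beta / 4) dEpot)) _).
have := Re_inner_i a b w; rewrite -vE.
rewrite {1}/w Re_innerDl Re_innerZl (Re_inner_skew _ _ _ _ _ (D1_skew a b N)).
rewrite Re_inner_cmul /GRing.scale /= => <-.
by field.
Qed.
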